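(* Let $\mathcal{M}$ be a finite set of users and $\mathcal{R}$ a finite set of resource blocks, with given $\delta_r^k\in\{0,1\}$ and positive integers $d_k$. Let $\mathcal{X}(\mathcal{M})$ denote the set of $\mathbf{x}\in\{0,1\}^{R\times|\mathcal{M}|}$ satisfying $\sum_r x_r^k\ge d_k$ for $k\in\mathcal{M}$, $\sum_k x_r^k\le 1$ for $r\in\mathcal{R}$, and $x_r^k\le\delta_r^k$ for all $(r,k)$. Consider Algorithm 1: draw costs $c_r^k$ independently and uniformly at random from $[0,1]$, and solve the linear program $\min\sum_r\sum_k c_r^k x_r^k$ over the relaxation of $\mathcal{X}(\mathcal{M})$ obtained by replacing $\mathbf{x}\in\{0,1\}^{R\times|\mathcal{M}|}$ with $\mathbf{x}\in[0,1]^{R\times|\mathcal{M}|}$; if the LP is feasible, answer ''yes'' and return the LP optimal solution $\mathbf{x}^*$ as a schedule, and otherwise answer ''no''. Then Algorithm 1 always answers correctly whether $\mathcal{X}(\mathcal{M})$ is nonempty, and, when the answer is ''yes'', with probability $1$ the returned $\mathbf{x}^*$ belongs to $\mathcal{X}(\mathcal{M})$.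
   Context: Binary SNR model of URLLC scheduling: $x_r^k=1$ means block $r$ is assigned to user $k$, $\delta_r^k=1$ means block $r$ is active for user $k$, and user $k$ is satisfied if it receives at least $d_k$ active blocks; each block goes to at most one user. $\mathcal{X}(\mathcal{M})\neq\emptyset$ means the user set $\mathcal{M}$ can be scheduled simultaneously (question Q1). *)

(* Defs.v *)
From HB Require Import structures.
From mathcomp Require Import all_boot all_order all_algebra.
From mathcomp Require Import all_classical all_reals all_analysis.
Set Implicit Arguments. Unset Strict Implicit. Unset Printing Implicit Defensive.
Import Order.TTheory GRing.Theory Num.Theory.
Local Open Scope classical_set_scope.
Local Open Scope ring_scope.

Section URLLC.
Variables (R : realType) (Rb M : finType).
(* Rb = resource blocks, M = users *)
Variables (delta : Rb -> M -> bool) (d : M -> nat).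

Definition int_feasible (x : Rb -> M -> bool) : Prop :=
  (forall k, d k <= \sum_(r : Rb) (x r k : nat))%N /\
  (forall r, \sum_(k : M) (x r k : nat) <= 1)%N /\
  (forall r k, x r k ==> delta r k).

Definition in_X (x : Rb -> M -> R) : Prop :=
  exists b : Rb -> M -> bool, int_feasible b /\ forall r k, x r k = (b r k)%:R.

Definition X_nonempty : Prop := exists b : Rb -> M -> bool, int_feasible b.

Definition lp_feasible (x : Rb -> M -> R) : Prop :=
  (forall r k, 0 <= x r k <= 1) /\
  (forall k, (d k)%:R <= \sum_(r : Rb) x r k) /\
  (forall r, \sum_(k : M) x r k <= 1) /\
  (forall r k, x r k <= (delta r k)%:R).

Definition lp_cost (c : Rb -> M -> R) (x : Rb -> M -> R) : R :=
  \sum_(r : Rb) \sum_(k : M) c r k * x r k.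

Definition lp_optimal (c : Rb -> M -> R) (x : Rb -> M -> R) : Prop :=
  lp_feasible x /\ forall y, lp_feasible y -> lp_cost c x <= lp_cost c y.

End URLLC.

Definition mutually_independent {d : measure_display} {T : measurableType d}
  {R : realType} {I : finType} (P : probability T R) (X : I -> T -> R) : Prop :=
  forall B : I -> set R, (forall i, measurable (B i)) ->
    P (\bigcap_(i in [set: I]) (X i @^-1` B i)) =
    (\big[*%E/1%E]_(i : I) P (X i @^-1` B i))%E.

Definition uniform01 {d : measure_display} {T : measurableType d}
  {R : realType} (P : probability T R) (X : T -> R) : Prop :=
  forall B : set R, measurable B ->
    P (X @^-1` B) = (@lebesgue_measure R) (B `&` `[0%R, 1%R]).

(* Main.v *)
Require Import Defs.
From HB Require Import structures.
From mathcomp Require Import all_boot all_order all_algebra.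
From mathcomp Require Import all_classical all_reals all_analysis.
From mathcomp Require Import lra zify.
Import Order.TTheory GRing.Theory Num.Theory.
Local Open Scope classical_set_scope.
Local Open Scope ring_scope.

(* The fractional entries of a feasible point [x] are the unknowns of the linear
   system "the tight row and column sums do not change".  By integrality of the
   right-hand sides, a tight row or column that contains a fractional entry
   contains at least two, so the system has at most as many equations as unknowns;
   when the numbers agree, the equations are dependent.  Hence [x] can be moved
   both ways along a nonzero direction [y] determined by its set of tight
   constraints.  Moving until a further constraint becomes tight, and iterating,
   gives an integral feasible point.  If [x] is optimal, its cost is constant
   along [y], so [c] lies on one of finitely many fixed hyperplanes, which has
   probability [0]. *)

(** * Linear algebra and counting on finite sets *)

Lemma underdetermined_system_solution (F : fieldType) (E V : finType)
    (A : {set E}) (B : {set V}) (a : V -> E -> F) :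
  (#|B| < #|A|)%N ->
  exists y : E -> F, [/\ exists e, y e != 0, forall e, e \notin A -> y e = 0 &
    forall v, v \in B -> \sum_e a v e * y e = 0].
Proof.
move=> ltBA.
pose Q : 'M[F]_(#|A|, #|B|) := \matrix_(i, j) a (enum_val j) (enum_val i).
(* The rank of [Q] is at most its number of columns, hence below its number of rows. The kernel
   vector [u] is then extended by zero outside [A]. *)
have /rowV0Pn[u uQ u0] : kermx Q != 0.
  by rewrite kermx_eq0 -row_leq_rank -ltnNge (leq_ltn_trans (rank_leq_col _)).
move/sub_kermxP: uQ => uQ.
pose y e := \sum_(i < #|A|) u 0 i * (enum_val i == e)%:R.
have yE i : y (enum_val i) = u 0 i.
  rewrite /y (bigD1 i)//= eqxx mulr1 big1 ?addr0// => j ji.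
  by rewrite (inj_eq enum_val_inj) (negbTE ji) mulr0.
exists y; split.
- have [i ui] : exists i, u 0 i != 0.
    apply/existsP; apply: contraNT u0; rewrite negb_exists => /forallP u0.
    by apply/eqP/rowP => i; rewrite mxE; apply/eqP; rewrite -[_ == _]negbK.
  by exists (enum_val i); rewrite yE.
- move=> e eA; rewrite /y big1// => i _.
  case: eqP => [ie|]; last by rewrite mulr0.
  by move: eA; rewrite -ie enum_valP.
- move=> v vB.
  have := congr1 (fun w : 'rV_#|B| => w 0 (enum_rank_in vB v)) uQ.
  rewrite !mxE => uv; rewrite -[RHS]uv.
  under [LHS]eq_bigr do rewrite mulr_sumr.
  rewrite exchange_big; apply: eq_bigr => i _ /=.
  rewrite (bigD1 (enum_val i))//= eqxx big1 ?addr0.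
    by rewrite mulr1 mulrC mxE enum_rankK_in.
  by move=> e; rewrite eq_sym => /negbTE ->; rewrite !mulr0.
Qed.

(** Fibres over distinct points are disjoint. With [f] a projection, this counts fractional entries
    row by row or column by column. *)
Lemma double_card_le_fibers (E V : finType) (f : E -> V) (F : {set E})
    (W : {set V}) :
  (forall v, v \in W -> 1 < #|[set e in F | f e == v]|)%N ->
  (2 * #|W| <= #|[set e in F | f e \in W]|)%N.
Proof.
move=> deg; rewrite -(sum1_card (mem [set e in F | _])) (partition_big f (mem W)) /=; last first.
  by move=> e; rewrite inE => /andP[].
rewrite mulnC -sum_nat_const; apply: leq_sum => v vW.
apply: leq_trans (deg v vW) _; rewrite -sum1_card; apply: eq_leq; apply: eq_bigl => e.
by rewrite !inE; case: eqP => [->|]; rewrite ?vW ?andbT ?andbF.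
Qed.

(** Otherwise [x i] would be a difference of two integers lying strictly between 0 and 1. *)
Lemma natr_sum_fractional (R : realType) (I : finType) (x : I -> R) (i : I) (n : nat) :
  0 < x i < 1 -> \sum_j x j = n%:R ->
  exists2 j, j != i & (x j != 0) && (x j != 1).
Proof.
move=> /andP[xi0 xi1] sx.
apply/exists_inP; apply: contraT; rewrite negb_exists_in => /forall_inP H.
have Hn : \sum_(j | j != i) x j = (\sum_(j | j != i) ((x j == 1)%R : nat))%:R.
  rewrite natr_sum; apply: eq_bigr => j /H; rewrite negb_and !negbK.
  by case/orP => /eqP ->; rewrite ?eqxx // eq_sym oner_eq0.
move: sx; rewrite (bigD1 i)//= Hn; set m := \sum_(j | _) _ => sx.
have : (m < n)%N by rewrite -(ltr_nat R) -sx ltrDr.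
by rewrite -(ler_nat R) -[m.+1%:R]natr1; lra.
Qed.

Lemma sum_pair (V : nmodType) (I J : finType) (f : I * J -> V) :
  \sum_e f e = \sum_i \sum_j f (i, j).
Proof. by rewrite pair_bigA; apply: eq_bigr => -[]. Qed.

(** * Geometry of the LP polytope *)

Section Polytope.
Variables (R : realType) (Rb M : finType).
Variables (delta : Rb -> M -> bool) (d : M -> nat).
Implicit Types (x : Rb -> M -> R) (y : Rb * M -> R).

(* The bound [x <= 1] is left out: it is implied by [x <= delta]. *)
Definition constraint : finType := ((Rb * M + Rb * M) + (Rb + M))%type.

(** All constraints take the form [0 <= slack x i], so that tightness is vanishing and [slack_dir]
    is the linear part. *)
Definition slack x (i : constraint) : R :=
  match i with
  | inl (inl e) => x e.1 e.2
  | inl (inr e) => (delta e.1 e.2)%:R - x e.1 e.2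
  | inr (inl r) => 1 - \sum_k x r k
  | inr (inr k) => \sum_r x r k - (d k)%:R
  end.

Definition slack_dir y (i : constraint) : R :=
  match i with
  | inl (inl e) => y e
  | inl (inr e) => - y e
  | inr (inl r) => - \sum_k y (r, k)
  | inr (inr k) => \sum_r y (r, k)
  end.

Definition shift x (t : R) y : Rb -> M -> R := fun r k => x r k + t * y (r, k).

Definition tight x : {set constraint} := [set i | slack x i == 0]%SET.

Lemma lp_feasibleP x :
  lp_feasible delta d x <-> forall i, 0 <= slack x i.
Proof.
split=> [[x01 [col [row up]]] [[e|e]|[r|k]] /=|H].
- by case/andP: (x01 e.1 e.2).
- by rewrite subr_ge0.
- by rewrite subr_ge0.
- by rewrite subr_ge0.
have up r k : x r k <= (delta r k)%:R.
  by have := H (inl (inr (r, k))); rewrite /= subr_ge0.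
split; last split; last split => //.
- move=> r k; apply/andP; split; first exact: (H (inl (inl (r, k)))).
  by apply: le_trans (up r k) _; rewrite lern1 leq_b1.
- by move=> k; have := H (inr (inr k)); rewrite /= subr_ge0.
- by move=> r; have := H (inr (inl r)); rewrite /= subr_ge0.
Qed.

Lemma slack_shift x t y i :
  slack (shift x t y) i = slack x i + t * slack_dir y i.
Proof.
case: i => [[[r k]|[r k]]|[r|k]] /=; rewrite /shift //=.
- by rewrite mulrN opprD addrA.
- by rewrite big_split /= -mulr_sumr mulrN opprD addrA.
- by rewrite big_split /= -mulr_sumr addrAC.
Qed.

Lemma slack_dir_opp y i : slack_dir (fun e => - y e) i = - slack_dir y i.
Proof. by case: i => [[e|e]|[r|k]] //=; rewrite sumrN. Qed.

Lemma lp_cost_shift (c : Rb -> M -> R) x t y :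
  lp_cost c (shift x t y) = lp_cost c x + t * \sum_e c e.1 e.2 * y e.
Proof.
rewrite /lp_cost /shift.
rewrite sum_pair /= -/(lp_cost c x).
rewrite mulr_sumr -big_split; apply: eq_bigr => r _ /=.
rewrite mulr_sumr -big_split; apply: eq_bigr => k _ /=.
by rewrite mulrDr mulrCA.
Qed.

(** Phrased by slacks, so that an entry outside the set has a tight bound. At a feasible point these
    are the entries other than 0 and 1, since [delta = 0] forces the entry to be 0. *)
Definition fractional x : {set Rb * M} :=
  [set e | (slack x (inl (inl e)) != 0) && (slack x (inl (inr e)) != 0)]%SET.

Lemma in_fractional x r k : lp_feasible delta d x ->
  ((r, k) \in fractional x) = (x r k != 0) && (x r k != 1).
Proof.
move=> /lp_feasibleP H; rewrite inE /=.
have := H (inl (inl (r, k))); have := H (inl (inr (r, k))); rewrite /=.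
case: (delta r k); first by rewrite subr_eq0 [1 == _]eq_sym.
rewrite sub0r oppr_eq0 oppr_ge0 => x0 x1.
have -> : x r k = 0 by apply/eqP; rewrite eq_le x0 x1.
by rewrite eqxx.
Qed.

Lemma fractional_lt x r k : lp_feasible delta d x ->
  (r, k) \in fractional x -> 0 < x r k < 1.
Proof.
move=> fx; rewrite (in_fractional _ _ _ fx) => /andP[x0 x1].
case: fx => /(_ r k)/andP[a b] _.
by rewrite !lt_def x0 a b eq_sym x1.
Qed.

Lemma fractional0_in_X x : lp_feasible delta d x -> fractional x = finset.set0 ->
  in_X delta d x.
Proof.
move=> fx F0.
have xE r k : x r k = (x r k == 1)%:R.
  have := in_fractional _ r k fx; rewrite F0 inE => /esym/negbT.
  by rewrite negb_and !negbK => /orP[]/eqP ->; rewrite ?eqxx // eq_sym oner_eq0.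
exists (fun r k => x r k == 1); split=> //.
case: fx => _ [col [row up]]; split; last split.
- move=> k; rewrite -(ler_nat R) natr_sum; apply: le_trans (col k) _.
  by apply: ler_sum => r _; rewrite -xE.
- move=> r; rewrite -(ler_nat R) natr_sum; apply: le_trans _ (row r).
  by apply: ler_sum => k _; rewrite -xE.
- move=> r k; apply/implyP => /eqP x1; move: (up r k); rewrite x1.
  by case: (delta r k); rewrite // ler10.
Qed.

(* If every fractional entry lies in a tight row and a tight column, one equation
   can be dropped, since the row sums and the column sums have the same total. *)
Lemma fractional_direction x : lp_feasible delta d x -> fractional x != finset.set0 ->
  exists y, (exists e, y e != 0) /\ forall i, i \in tight x -> slack_dir y i = 0.
Proof.
move=> fx /set0Pn[e0 e0F]; pose F := fractional x.
(* View [F] as the edges of a bipartite graph on rows and columns, with incidence matrix [a]. Tight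
   rows and columns without fractional entries give no equation, because [y] will be supported on
   [F]. *)
pose Wr := [set r | (inr (inl r) \in tight x) && [exists k, (r, k) \in F]]%SET.
pose Wc := [set k | (inr (inr k) \in tight x) && [exists r, (r, k) \in F]]%SET.
pose B := ([set inl r | r in Wr] :|: [set inr k | k in Wc])%SET : {set Rb + M}.
pose a (v : Rb + M) (e : Rb * M) : R :=
  match v with inl r => (e.1 == r)%:R | inr k => (e.2 == k)%:R end.
have arow y r : \sum_e a (inl r) e * y e = \sum_k y (r, k).
  rewrite sum_pair /=.
  rewrite (bigD1 r)//= [X in _ + X]big1 ?addr0.
    by apply: eq_bigr => k _; rewrite eqxx mul1r.
  by move=> s /negbTE sr; rewrite big1// => k _; rewrite sr mul0r.
have acol y k : \sum_e a (inr k) e * y e = \sum_r y (r, k).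
  rewrite sum_pair /=.
  apply: eq_bigr => r _.
  rewrite (bigD1 k)//= eqxx mul1r big1 ?addr0// => l /negbTE ->.
  by rewrite mul0r.
have degr r : r \in Wr -> (1 < #|[set e in F | e.1 == r]%SET|)%N.
  rewrite !inE => /andP[/eqP]; rewrite /= => /eqP; rewrite subr_eq0 eq_sym => /eqP sr.
  move=> /existsP[k kF].
  have [l lk lF] := natr_sum_fractional _ _ (x r) k 1 (fractional_lt _ _ _ fx kF) sr.
  apply/card_gt1P; exists (r, k), (r, l); rewrite !inE; split.
  - by move: kF; rewrite inE => ->; rewrite eqxx.
  - by rewrite -in_fractional// in lF; move: lF; rewrite inE => ->; rewrite eqxx.
  - by apply: contra lk => /eqP[->].
have degc k : k \in Wc -> (1 < #|[set e in F | e.2 == k]%SET|)%N.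
  rewrite !inE => /andP[/eqP]; rewrite /= => /eqP; rewrite subr_eq0 => /eqP sk.
  move=> /existsP[r rF].
  have [s sr sF] := natr_sum_fractional _ _ (fun r => x r k) r _ (fractional_lt _ _ _ fx rF) sk.
  apply/card_gt1P; exists (r, k), (s, k); rewrite !inE; split.
  - by move: rF; rewrite inE => ->; rewrite eqxx.
  - by rewrite -in_fractional// in sF; move: sF; rewrite inE => ->; rewrite eqxx.
  - by apply: contra sr => /eqP[->].
have cB : (#|B| <= #|Wr| + #|Wc|)%N.
  by rewrite (leq_trans (leq_card_setU _ _))// leq_add// leq_imset_card.
have cr := double_card_le_fibers _ _ fst F Wr degr.
have cc := double_card_le_fibers _ _ snd F Wc degc.
set Fr := [set e in F | e.1 \in Wr]%SET in cr.
set Fc := [set e in F | e.2 \in Wc]%SET in cc.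
have FrF : Fr \subset F by apply/fintype.subsetP => e; rewrite inE => /andP[].
have FcF : Fc \subset F by apply/fintype.subsetP => e; rewrite inE => /andP[].
have cFr := subset_leq_card FrF; have cFc := subset_leq_card FcF.
suff [y [ynz yF yr yc]] : exists y, [/\ exists e, y e != 0,
    forall e, e \notin F -> y e = 0,
    forall r, r \in Wr -> \sum_k y (r, k) = 0 &
    forall k, k \in Wc -> \sum_r y (r, k) = 0].
  exists y; split=> // -[[e|e]|[r|k]] /=.
  - by rewrite inE => e0'; apply: yF; rewrite inE e0'.
  - by rewrite inE => e0'; rewrite yF ?oppr0// inE e0' andbF.
  - move=> tr; have [rW|] := boolP (r \in Wr); first by rewrite yr ?oppr0.
    rewrite inE tr /= negb_exists => /forallP rF.
    by rewrite big1 ?oppr0// => k _; rewrite yF.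
  - move=> tk; have [kW|] := boolP (k \in Wc); first by rewrite yc.
    rewrite inE tk /= negb_exists => /forallP kF.
    by rewrite big1// => r _; rewrite yF.
have inlB r : r \in Wr -> inl r \in B.
  by move=> rW; rewrite inE imset_f.
have inrB k : k \in Wc -> inr k \in B.
  by move=> kW; rewrite inE (imset_f inr kW) orbT.
(* The bounds give [|B| <= |Wr| + |Wc| <= (|Fr| + |Fc|) / 2 <= |F|], strictly if [Fr] or [Fc] misses
   an entry of [F]. *)
have [FE|neF] := boolP ((Fr == F) && (Fc == F)); last first.
  have ltBF : (#|B| < #|F|)%N.
    have arith b p q m m' f : (b <= p + q -> 2 * p <= m -> 2 * q <= m' ->
      m <= f -> m' <= f -> (m < f) || (m' < f) -> b < f)%N by lia.
    apply: arith cB cr cc cFr cFc _.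
    by move: neF; rewrite negb_and => /orP[] ne; apply/orP; [left|right];
      rewrite proper_card// finset.properEneq ne.
  have [y [ynz yF yB]] := underdetermined_system_solution _ _ _ _ _ a ltBF.
  exists y; split=> // [r rW|k kW].
  - by rewrite -arow yB// inlB.
  - by rewrite -acol yB// inrB.
case/andP: FE => /eqP FrE /eqP FcE.
have rW0 : e0.1 \in Wr by have := e0F; rewrite -/F -FrE inE => /andP[].
have ltBF : (#|B :\ inl e0.1| < #|F|)%N.
  have arith b p q m m' f : (b <= p + q -> 2 * p <= m -> 2 * q <= m' ->
    m <= f -> m' <= f -> b <= f)%N by lia.
  have := arith _ _ _ _ _ _ cB cr cc cFr cFc.
  by rewrite (cardsD1 (inl e0.1) B) inlB.
have [y [ynz yF yB]] := underdetermined_system_solution _ _ _ _ _ a ltBF.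
(* Since [Fc = F], columns outside [Wc] contain no entry of [F], so all column sums vanish; likewise
   all row sums except that of the dropped row [e0.1], which the total then determines. *)
have yc k : \sum_r y (r, k) = 0.
  have [kW|kW] := boolP (k \in Wc); first by rewrite -acol yB// finset.in_setD1 inrB.
  by rewrite big1// => r _; rewrite yF// -FcE inE negb_and kW orbT.
have yr r : r != e0.1 -> \sum_k y (r, k) = 0.
  move=> re; have [rW|rW] := boolP (r \in Wr).
    rewrite -arow yB// finset.in_setD1 inlB// andbT.
    by apply: contra re => /eqP[->].
  by rewrite big1// => k _; rewrite yF// -FrE inE negb_and rW orbT.
exists y; split=> // r rW; have [->|] := eqVneq r e0.1; last exact: yr.
have: \sum_r \sum_k y (r, k) = 0.
  by rewrite exchange_big big1.
by rewrite (bigD1 e0.1)//= [X in _ + X]big1 ?addr0.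
Qed.

(** This is the ratio test of the simplex method: [t] is the least [f i / - g i] over the decreasing
    coordinates. *)
Lemma step_until_tight (I : finType) (f g : I -> R) :
  (forall i, 0 <= f i) -> (forall i, f i = 0 -> g i = 0) -> (exists i, g i < 0) ->
  exists t, [/\ 0 < t, forall i, 0 <= f i + t * g i &
    exists2 i, f i != 0 & f i + t * g i = 0].
Proof.
move=> f0 fg [i0 gi0].
case: (Order.TotalTheory.arg_minP (P := fun i => g i < 0) (fun i => f i / - g i) gi0).
move=> i gi mini; exists (f i / - g i).
have fi : f i != 0 by apply: contraTneq gi => /fg ->; rewrite ltxx.
have fp : 0 < f i by rewrite lt_def fi f0.
have tp : 0 < f i / - g i by rewrite divr_gt0// oppr_gt0.
split=> //.
- move=> j; have [gj|gj] := ltP (g j) 0; last by rewrite addr_ge0// mulr_ge0// ltW.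
  have := mini j gj; rewrite ler_pdivlMr ?oppr_gt0//.
  by rewrite mulrN -subr_ge0 opprK.
- by exists i => //; rewrite invrN mulrN mulNr mulfVK ?subrr// lt_eqF.
Qed.

Lemma feasible_step x y : lp_feasible delta d x -> (exists e, y e != 0) ->
  (forall i, i \in tight x -> slack_dir y i = 0) ->
  exists t, [/\ 0 < t, lp_feasible delta d (shift x t y) &
    tight x \proper tight (shift x t y)].
Proof.
move=> /lp_feasibleP fx [e ye] ty.
have [|||t [t0 Ht [i fi Hi]]] := step_until_tight _ (slack x) (slack_dir y).
- exact: fx.
- by move=> i xi; apply: ty; rewrite inE xi.
(* The lower and upper bounds of the entry [e] have opposite slopes, so one of these slacks
   decreases. *)
- have [y0|y0] := ltP (y e) 0; first by exists (inl (inl e)).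
  by exists (inl (inr e)); rewrite /= oppr_lt0 lt_def ye.
exists t; split=> //.
  by apply/lp_feasibleP => j; rewrite slack_shift.
apply/fintype.properP; split.
  apply/fintype.subsetP => j jt; rewrite inE slack_shift ty// mulr0 addr0.
  by rewrite inE in jt.
by exists i; rewrite inE// slack_shift Hi.
Qed.

(** Induction on the number of constraints that are not tight, which drops at each step. *)
Lemma lp_feasible_X_nonempty x : lp_feasible delta d x -> X_nonempty delta d.
Proof.
have [n] := ubnP #|~: tight x|; elim: n x => // n IH x ltn fx.
have [F0|Fn0] := eqVneq (fractional x) finset.set0.
  by have [b [bX _]] := fractional0_in_X _ fx F0; exists b.
have [y [ynz ty]] := fractional_direction _ fx Fn0.
have [t [_ fxt pxt]] := feasible_step _ _ fx ynz ty.
apply: (IH _ _ fxt); rewrite -ltnS; apply: leq_trans ltn; rewrite ltnS.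
by apply: proper_card; rewrite finset.properC.
Qed.

(** Both [y] and [- y] allow a positive feasible step, so optimality makes the slope of the cost
    nonnegative along each. *)
Lemma optimal_direction (c : Rb -> M -> R) x y : lp_optimal delta d c x ->
  (exists e, y e != 0) -> (forall i, i \in tight x -> slack_dir y i = 0) ->
  \sum_e c e.1 e.2 * y e = 0.
Proof.
move=> [fx ox] ynz ty.
have nonneg z : (exists e, z e != 0) ->
    (forall i, i \in tight x -> slack_dir z i = 0) ->
    0 <= \sum_e c e.1 e.2 * z e.
  move=> znz tz; have [t [t0 fxt _]] := feasible_step _ _ fx znz tz.
  by have := ox _ fxt; rewrite lp_cost_shift lerDl pmulr_rge0.
apply/eqP; rewrite eq_le nonneg// andbT -oppr_ge0 -sumrN.
under eq_bigr do rewrite -mulrN.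
apply: nonneg.
- by case: ynz => e ye; exists e; rewrite oppr_eq0.
- by move=> i it; rewrite slack_dir_opp ty// oppr0.
Qed.

End Polytope.

(** * Probability bounds for boxes and unions *)

Lemma lee_prod_EFin (R : realType) (I : finType) (f : I -> \bar R) (g : I -> R) :
  (forall i, 0 <= f i)%E -> (forall i, f i <= (g i)%:E)%E ->
  (\prod_i f i <= (\prod_i g i)%:E)%E.
Proof.
move=> f0 fg; rewrite -prodEFin.
suff /andP[] : ((0 <= \prod_i f i) && (\prod_i f i <= \prod_i (g i)%:E))%E by [].
apply: (big_ind2 (fun x y : \bar R => is_true ((0 <= x) && (x <= y))%E)).
- by rewrite lee01 lexx.
- move=> x1 x2 y1 y2 /andP[? ?] /andP[? ?].
  by rewrite mule_ge0//= lee_pmul.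
- by move=> i _; rewrite f0 fg.
Qed.

Lemma measure_bigsetU_le (dT : measure_display) (T : measurableType dT) (R : realType)
    (P : probability T R) (I : Type) (s : seq I) (Q : pred I) (D : I -> set T) (b : R) :
  (forall i, measurable (D i)) -> (forall i, Q i -> (P (D i) <= b%:E)%E) ->
  (P (\big[setU/set0]_(i <- s | Q i) D i) <= (\sum_(i <- s | Q i) b)%:E)%E.
Proof.
move=> mD leb; elim: s => [|i s IH]; first by rewrite !big_nil measure0.
rewrite !big_cons; case: ifP => // Qi.
rewrite EFinD; apply: le_trans (measureU2 _ _ _) _ => //.
  by apply: bigsetU_measurable => j _.
by rewrite leeD// leb.
Qed.

Lemma uniform01_itv_le (dT : measure_display) (T : measurableType dT) (R : realType)
    (P : probability T R) (X : T -> R) (a b l : R) :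
  a <= b -> b - a = l -> uniform01 P X -> (P (X @^-1` `[a, b]) <= l%:E)%E.
Proof.
move=> ab <- uX; rewrite uX//.
apply: (@le_trans _ _ (lebesgue_measure `[a, b])).
  by apply: le_measure; rewrite ?inE//; exact: measurableI.
rewrite lebesgue_measure_itv /= lte_fin; case: ifP => _; first by rewrite -EFinB.
by rewrite lee_fin subr_ge0.
Qed.

(** Excluding the value 1, a null event, ensures that rounding down to multiples of [1 / N] gives an
    index below [N]. *)
Lemma uniform01_ae (dT : measure_display) (T : measurableType dT) (R : realType)
    (P : probability T R) (X : T -> R) : measurable_fun setT X ->
  uniform01 P X -> {ae P, forall w, 0 <= X w < 1}.
Proof.
move=> mX uX; exists (X @^-1` (~` `[0, 1[)); split.
- by rewrite -[_ @^-1` _]setTI; apply: mX => //; exact: measurableC.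
- rewrite uX; last exact: measurableC.
  apply/eqP; rewrite -measure_le0.
  apply: (@le_trans _ _ (lebesgue_measure [set 1 : R])); last first.
    by rewrite lebesgue_measure_set1.
  apply: le_measure; rewrite ?inE//; first by apply: measurableI => //; exact: measurableC.
  move=> x [/=]; rewrite !in_itv /= => x01 /andP[x0 x1].
  apply/eqP; rewrite eq_le x1 leNgt; apply/negP => xl1; apply: x01.
  by rewrite x0 xl1.
- by move=> w /= Xw; rewrite in_itv.
Qed.

(** * Hyperplanes are null for independent uniform coordinates *)

Section LinearCombination.
Variables (R : realType) (E : finType).
Variables (dT : measure_display) (T : measurableType dT) (P : probability T R).
Variable c : E -> T -> R.
Hypothesis c_meas : forall e, measurable_fun setT (c e).
Hypothesis c_indep : mutually_independent P c.
Hypothesis c_unif : forall e, uniform01 P (c e).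

(* The unit cube in the coordinates other than [e0] is cut into cubes of side
   [1 / N]; above each of them the hyperplane has height at most [2 L / N]. *)
Lemma hyperplane_cover (e0 : E) (z : E -> R) (n : nat) :
  exists D : set T, [/\ measurable D,
    (P D <= (2 * (\sum_(e | e != e0) `|z e|) / n.+1%:R)%:E)%E &
    forall w, (forall e, 0 <= c e w < 1) ->
      c e0 w = \sum_(e | e != e0) z e * c e w -> D w].
Proof.
set L := \sum_(e | _) _; set N := n.+1.
have L0 : 0 <= L by apply: sumr_ge0.
have N0 : 0 < N%:R :> R by rewrite ltr0n.
have NI0 : 0 <= N%:R^-1 :> R by rewrite invr_ge0 ltW.
pose a (q : {ffun E -> 'I_N}) : R := \sum_(e | e != e0) z e * ((q e)%:R / N%:R).
pose I (q : {ffun E -> 'I_N}) (e : E) : set R :=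
  [set` if e == e0 then `[a q - L / N%:R, a q + L / N%:R]
        else `[(q e)%:R / N%:R, (q e).+1%:R / N%:R]].
pose D q := \bigcap_(e in [set: E]) (c e @^-1` I q e).
pose Q := pffun_on (ord0 : 'I_N) (predC1 e0) predT.
pose b (e : E) : R := if e == e0 then 2 * L / N%:R else N%:R^-1.
have mI q e : measurable (I q e) by rewrite /I; case: ifP.
have mD q : measurable (D q).
  apply: fin_bigcap_measurable => // e _.
  by rewrite -[_ @^-1` _]setTI; apply: c_meas.
have PD q : (P (D q) <= (\prod_e b e)%:E)%E.
  rewrite /D c_indep//; apply: lee_prod_EFin => // e.
  rewrite /I /b; case: ifP => _.
  - by apply: uniform01_itv_le; [have := mulr_ge0 L0 NI0; lra|lra|].
  - apply: uniform01_itv_le => //; first by rewrite ler_wpM2r// ler_nat.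
    by rewrite -mulrBl -natr1 addrAC subrr add0r mul1r.
(* There are [N ^ (|E| - 1)] cells, and the side lengths [1 / N] of each cancel this number. *)
have bE : \sum_(q in Q) \prod_e b e = 2 * L / N%:R.
  rewrite sumr_const card_pffun_on card_ord cardC1 (bigD1 e0)//= {1}/b eqxx.
  rewrite (eq_bigr (fun=> N%:R^-1)); last by move=> e /negbTE; rewrite /b => ->.
  rewrite prodr_const cardC1 -mulrnAr -[X in _ * X]mulr_natr natrX -exprMn.
  by rewrite mulVf ?gt_eqF// expr1n mulr1.
exists (\big[setU/set0]_(q in Q) D q); split.
- exact: bigsetU_measurable.
- by rewrite -bE; apply: measure_bigsetU_le.
- move=> w c01 cw.
  pose q : {ffun E -> 'I_N} :=
    [ffun e => if e == e0 then ord0 else inord (Num.trunc (c e w * N%:R))].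
  have qQ : q \in Q.
    apply/pffun_onP; split=> //; apply/fintype.subsetP => e; rewrite !inE ffunE /=.
    by case: (e == e0); rewrite ?eqxx.
  suff : D q w by rewrite (bigD1 q)//=; left.
  have qe e : e != e0 -> (q e)%:R <= c e w * N%:R < (q e).+1%:R.
    move=> /negbTE ee0; have /andP[c0 c1] := c01 e.
    have cN0 : 0 <= c e w * N%:R by rewrite mulr_ge0// ltW.
    rewrite ffunE ee0 inordK; first exact: truncn_itv.
    by rewrite truncn_lt_nat// gtr_pMl.
  have qi e : e != e0 -> (q e)%:R / N%:R <= c e w <= (q e).+1%:R / N%:R.
    by move=> /qe /andP[? /ltW ?]; rewrite ler_pdivrMr// ler_pdivlMr//; apply/andP.
  move=> e _; rewrite /I /=; case: eqP => [->|/eqP/qi]; rewrite /= in_itv//=.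
  (* Each coordinate is within [1 / N] of its corner, so the height differs from [a q] by at most
     [L / N]. *)
  rewrite -ler_distl cw /a -sumrB; apply: le_trans (ler_norm_sum _ _ _) _.
  rewrite mulr_suml; apply: ler_sum => f /qi /andP[q1 q2].
  rewrite -mulrBr normrM ler_wpM2l// ger0_norm ?subr_ge0//.
  by rewrite lerBlDl; move: q2; rewrite -natr1 mulrDl mul1r.
Qed.

Lemma linear_combination_ae_neq0 (y : E -> R) : (exists e, y e != 0) ->
  {ae P, forall w, \sum_e c e w * y e != 0}.
Proof.
move=> [e0 ye0].
have c01 : {ae P, forall w, forall e, 0 <= c e w < 1}.
  by apply: filter_forall => e; apply: uniform01_ae.
(* The coefficients of the hyperplane solved for the coordinate [e0]. *)
pose z e := - y e / y e0.
suff : {ae P, forall w, (forall e, 0 <= c e w < 1) ->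
    c e0 w != \sum_(e | e != e0) z e * c e w}.
  apply: filterS2 c01 => w cw /(_ cw); apply: contra.
  rewrite (bigD1 e0)//= addr_eq0 => /eqP cy; apply/eqP.
  rewrite -[LHS](mulfK ye0) cy mulNr mulr_suml -sumrN; apply: eq_bigr => e _.
  by rewrite /z !mulNr [c e w * _]mulrC mulrAC.
have /choice[D HD] := hyperplane_cover e0 z.
exists (\bigcap_n D n); split.
- by apply: bigcap_measurableType => n _; case: (HD n).
- apply/eqP; rewrite -measure_le0; apply/lee_addgt0Pr => eps eps0.
  rewrite add0e; set L := \sum_(e | _) _ in HD.
  have [n Hn] : exists n, 2 * L / n.+1%:R <= eps.
    exists (Num.trunc (2 * L / eps)).
    rewrite ler_pdivrMr// -ler_pdivrMl// [_^-1 * _]mulrC; apply: ltW; exact: truncnS_gt.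
  have [mDn PDn _] := HD n.
  apply: (@le_trans _ _ (P (D n))).
    apply: le_measure; rewrite ?inE//; last by move=> w; apply.
    by apply: bigcap_measurableType => m _; case: (HD m).
  by apply: le_trans PDn _; rewrite lee_fin.
- move=> w /= /not_implyP[cw /negP]; rewrite negbK => /eqP cz n _.
  by have [_ _] := HD n; apply.
Qed.

End LinearCombination.

Theorem theorem2 (R : realType) (Rb M : finType)
  (delta : Rb -> M -> bool) (d : M -> nat) (hd : forall k, (0 < d k)%N)
  (dT : measure_display) (T : measurableType dT) (P : probability T R)
  (c : Rb * M -> T -> R)
  (c_meas : forall i, measurable_fun setT (c i))
  (c_indep : mutually_independent P c)
  (c_unif : forall i, uniform01 P (c i)) :
  ((exists x : Rb -> M -> R, lp_feasible delta d x) <-> @X_nonempty Rb M delta d) /\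
  ((exists x : Rb -> M -> R, lp_feasible delta d x) ->
     {ae P, forall w, forall x : Rb -> M -> R,
        lp_optimal delta d (fun r k => c (r, k) w) x -> @in_X R Rb M delta d x}).
Proof.
split; first split=> [[x]|[b [col [row up]]]].
- exact: lp_feasible_X_nonempty.
- exists (fun r k => (b r k)%:R); split; last split; last split.
  + by move=> r k; rewrite ler0n lern1 leq_b1.
  + by move=> k; rewrite -natr_sum ler_nat.
  + by move=> r; rewrite -natr_sum lern1.
  + by move=> r k; rewrite ler_nat; have := up r k; case: (b r k) (delta r k) => [] [].
(* One direction [Y S] is fixed for each set [S] of constraints, before the costs are drawn. There
   are finitely many [S], so almost surely no [Y S] that is a genuine direction is orthogonal to the
   costs. *)
move=> _; pose dir (S : {set constraint Rb M}) (y : Rb * M -> R) :=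
  (exists e, y e != 0) /\ forall i, i \in S -> slack_dir _ _ _ y i = 0.
have /choice[Y HY] S : exists y, (exists z, dir S z) -> dir S y.
  by have [[y Sy]|noS] := pselect (exists z, dir S z); [exists y|exists (fun=> 0)].
have : {ae P, forall w, forall S, (exists z, dir S z) -> \sum_e c e w * Y S e != 0}.
  apply: filter_forall => S; have [eS|noS] := pselect (exists z, dir S z).
    have [Ynz _] := HY S eS.
    by apply: filterS (linear_combination_ae_neq0 _ _ _ _ _ _ c_meas c_indep c_unif _ Ynz).
  by apply: aeW => w /noS.
apply: filterS => w generic x xopt; have [fx _] := xopt.
apply: fractional0_in_X => //; apply/eqP/negPn/negP => Fn0.
(* A fractional optimum would make [Y (tight x)] a genuine direction along which the cost is
   constant, contradicting [generic]. *)
have eS := fractional_direction _ _ _ _ _ _ fx Fn0.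
have [Ynz Ytight] := HY _ eS.
have s0 := optimal_direction _ _ _ _ _ _ _ _ xopt Ynz Ytight.
move/negP: (generic _ eS); apply; apply/eqP; rewrite -[RHS]s0.
by apply: eq_bigr => -[].
Qed.
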